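(* In the setting described in the context, let $b_0>a_0>b_1>a_1$ be real numbers and let $H\subset G_a$ be (measurable and) such that for every $\gamma\in H$ both $(a_0,b_0)\subset\phi_a(\gamma_{(0,1)})$ and $(a_1,b_1)\subset\phi_a(\gamma_{(0,1)})$. For $\gamma\in H$ and $i=0,1$ let $R^\gamma_i,L^\gamma_i\in[0,1]$ be determined by $$\phi_a(\gamma_{R_i^\gamma})=b_i,\qquad\phi_a(\gamma_{R_i^\gamma+L_i^\gamma})=a_i,$$ and for $t\in[0,1]$ put $R^\gamma_t=(1-t)R^\gamma_0+tR^\gamma_1$, $L^\gamma_t=(1-t)L^\gamma_0+tL^\gamma_1$. Let $\eta$ be a probability measure on $\mathcal G(X)$ with $\eta(H)=1$ and define $$[0,1]\ni t\mapsto\nu_t:=\int_H\frac1{L^\gamma_t}\,\mathcal L^1\llcorner_{[R^\gamma_t,R^\gamma_t+L^\gamma_t]}\,\eta(d\gamma)\in\mathcal P([0,1]\times G_a),$$ where $\mathcal L^1\llcorner_{[R^\gamma_t,R^\gamma_t+L^\gamma_t]}$ is understood as a measure on $[0,1]\times\{\gamma\}$. Then $[0,1]\ni t\mapsto e_\sharp\nu_t$ is a $W_2$-geodesic, where $e(s,\gamma)=\gamma_s$.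
   Context: Setting: $(X,d,m)$ is a geodesic, non-branching, separable metric measure space (no curvature assumption), where non-branching means: for all $r\ge0$, $x,y$ with $d(x,y)=r/2$, the set $\{z:d(x,z)=r\}\cap\{z:d(y,z)=r/2\}$ has at most one point. $\mathcal G(X)$ is the space of constant speed geodesics $\gamma:[0,1]\to X$ with the uniform topology, $e_t(\gamma)=\gamma_t$. $\mu_t$ is a geodesic in the $L^2$-Wasserstein space ($W_2$ its distance), $\boldsymbol\gamma\in\mathcal P(\mathcal G(X))$ with $(e_t)_\sharp\boldsymbol\gamma=\mu_t$ for all $t$ and $(e_0,e_1)_\sharp\boldsymbol\gamma$ optimal, $G=\mathrm{supp}\,\boldsymbol\gamma$; geodesics in $G$ have positive length. $\varphi$ is a $d^2$-concave Kantorovich potential for $(\mu_0,\mu_1)$: $\varphi=v^c$ for some $v$, with $v^c(y)=\inf_x\frac12d^2(x,y)-v(x)$, and $(\varphi,\varphi^c)$ optimal in the dual problem with cost $d^2/2$. $a\in\varphi(\mathrm{supp}\,\mu_0)$, $G_a=\{\gamma\in G:\varphi(\gamma_0)=a\}$. $\phi_a:X\to\mathbb R$ is a $1$-Lipschitz function such that $\phi_a(\gamma_s)-\phi_a(\gamma_t)=d(\gamma_s,\gamma_t)$ for all $\gamma\in G_a$ and $0\le s\le t\le1$ (a Kantorovich potential for the $d$-cyclically monotone set $\{(\gamma_s,\gamma_t):\gamma\in G_a,s\le t\}$). *)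

(* Defs.v *)
From HB Require Import structures.
From mathcomp Require Import all_boot all_order all_algebra.
From mathcomp Require Import all_classical all_reals all_analysis.

Set Implicit Arguments.
Unset Strict Implicit.
Unset Printing Implicit Defensive.

Import Order.TTheory GRing.Theory Num.Theory.

Local Open Scope classical_set_scope.
Local Open Scope ring_scope.

(* Measurable types are pointed in the library, so metric spaces carrying a
   measure are taken with a distinguished (otherwise unused) point. *)
#[short(type="pmetricType")]
HB.structure Definition PMetric (K : numDomainType) :=
  {T of Metric K T & Pointed T}.

Notation borel T := (g_sigma_algebraType (@open T)).

Section metric_geometry.
Context {R : realType} (X : pmetricType R).

(* A curve [0,1] -> X is encoded by its extension to R that is constant on each
   side of [0,1]; thus two geodesics are equal iff they agree on [0,1]. *)
Record geodesic := Geodesic {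
  geodesic_fun :> R -> X ;
  geodesic_speed : forall s t, 0 <= s <= 1 -> 0 <= t <= 1 ->
    mdist (geodesic_fun s) (geodesic_fun t) =
    `|s - t| * mdist (geodesic_fun 0) (geodesic_fun 1) ;
  geodesic_ext : forall s,
    geodesic_fun s = geodesic_fun (Num.min 1 (Num.max 0 s)) }.

Definition geodesic_space :=
  forall x y : X, exists g : geodesic, g 0 = x /\ g 1 = y.

Definition non_branching :=
  forall (r : R) (x y : X), 0 <= r -> mdist x y = r / 2 ->
    is_subset1 ([set z | mdist x z = r] `&` [set z | mdist y z = r / 2]).

Definition separable_space :=
  exists2 S : set X, countable S & dense S.

Lemma cst_geodesic_speed (x : X) (s t : R) : 0 <= s <= 1 -> 0 <= t <= 1 ->
  mdist x x = `|s - t| * mdist x x.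
Proof. by rewrite mdistxx mulr0. Qed.

Definition cst_geodesic (x : X) : geodesic :=
  @Geodesic (fun=> x) (cst_geodesic_speed x) (fun=> erefl).

End metric_geometry.

Section geodesic_topology.
Context {R : realType} (X : pmetricType R).

HB.instance Definition _ := gen_eqMixin (geodesic X).
HB.instance Definition _ := gen_choiceMixin (geodesic X).
HB.instance Definition _ := isPointed.Build (geodesic X) (cst_geodesic point).

Definition geodesic_uniform_fun (g : geodesic X) : {uniform` `[0, 1] -> X} :=
  geodesic_fun g.

HB.instance Definition _ :=
  Uniform.copy (geodesic X) (initial_topology geodesic_uniform_fun).

End geodesic_topology.

Section measures.
Local Open Scope ereal_scope.
Context {R : realType}.

Definition is_probability d (T : measurableType d) (mu : set T -> \bar R) :=
  exists P : probability T R, forall A, measurable A -> mu A = P A.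

Definition supp (T : ptopologicalType) (mu : set (borel T) -> \bar R) : set T :=
  [set x | forall U : set T, open U -> U x -> 0 < mu U].

End measures.

Section optimal_transport.
Local Open Scope ereal_scope.
Context {R : realType} (X : pmetricType R).
Implicit Types (mu nu : set (borel X) -> \bar R)
  (pi : set (borel X * borel X) -> \bar R).

Definition finite_second_moment mu :=
  exists x0 : X, \int[mu]_x (mdist x0 (x : X) ^+ 2)%:E < +oo.

Definition coupling mu nu pi := forall A : set (borel X), measurable A ->
  pi (A `*` setT) = mu A /\ pi (setT `*` A) = nu A.

Definition quadratic_cost pi :=
  \int[pi]_z (mdist (z.1 : X) (z.2 : X) ^+ 2)%:E.

Definition optimal_coupling mu nu pi :=
  coupling mu nu pi /\
  forall pi' : probability (borel X * borel X)%type R,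
    coupling mu nu pi' -> quadratic_cost pi <= quadratic_cost pi'.

Definition W2 mu nu : \bar R :=
  poweR (ereal_inf [set quadratic_cost pi | pi in
    [set pi : probability (borel X * borel X)%type R | coupling mu nu pi]])
    (2^-1)%R.

(* Geodesic of (P(X), W2), where W2 may take the value +oo. Finite second
   moments are not part of the notion: W2 (mu s) (mu t) can be finite while
   mu s and mu t both have infinite second moment. *)
Definition W2_geodesic (mu : R -> set (borel X) -> \bar R) :=
  [/\ forall t, (0 <= t <= 1)%R -> is_probability (mu t),
      W2 (mu 0%R) (mu 1%R) < +oo &
      forall s t, (0 <= s <= 1)%R -> (0 <= t <= 1)%R ->
        W2 (mu s) (mu t) = `|s - t|%:E * W2 (mu 0%R) (mu 1%R)].

Definition c_transform (v : X -> \bar R) (y : X) : \bar R :=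
  ereal_inf [set (mdist x y ^+ 2 / 2)%:E - v x | x in [set: X]].

(* Competitors of the dual problem, with values in R `|` {-oo}. *)
Definition dual_admissible (mu nu : probability (borel X) R)
    (u w : X -> \bar R) :=
  [/\ mu.-integrable setT u, nu.-integrable setT w,
      forall x, u x != +oo, forall y, w y != +oo &
      forall x y, u x + w y <= (mdist x y ^+ 2 / 2)%:E].

Definition kantorovich_potential (mu nu : probability (borel X) R)
    (phi : X -> \bar R) :=
  [/\ exists v : X -> \bar R, phi = c_transform v,
      dual_admissible mu nu phi (c_transform phi) &
      forall u w, dual_admissible mu nu u w ->
        \int[mu]_x u x + \int[nu]_y w y <=
        \int[mu]_x phi x + \int[nu]_y c_transform phi y].

End optimal_transport.

Section layers.
Local Open Scope ereal_scope.
Context {R : realType} (X : pmetricType R).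

Definition ev (t : R) (g : borel (geodesic X)) : borel X :=
  (g : geodesic X) t.

Definition ev2 (s t : R) (g : borel (geodesic X)) : borel X * borel X :=
  (ev s g, ev t g).

Definition joint_ev (z : measurableTypeR R * borel (geodesic X)) : borel X :=
  ev z.1 z.2.

(* r + l is constrained to [0,1] because g is only meaningful there, see the
   extension convention in [geodesic]. *)
Definition crossing_times (psi : X -> R) (a b : R) (g : geodesic X) (r l : R) :=
  [/\ (0 <= r <= 1)%R, (0 <= l <= 1)%R, (0 <= r + l <= 1)%R,
      psi (g r) = b & psi (g (r + l)%R) = a].

(* The measure \int_H (l g)^-1 L^1|_[r g, r g + l g] eta(dg), evaluated on A;
   the Lebesgue measure lives on the slice R x {g}, whence the section of A. *)
Definition uniform_layer (eta : probability (borel (geodesic X)) R)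
    (H : set (geodesic X)) (r l : geodesic X -> R)
    (A : set (measurableTypeR R * borel (geodesic X))) : \bar R :=
  \int[eta]_(g in H)
    ((l g)^-1%:E * lebesgue_measure (`[r g, (r g + l g)%R] `&` ysection A g)).

End layers.

(* Main.v *)
(* Along [g] in [H] the potential [phia] decreases linearly in time, from
   [phia (g 0)] at rate the length of [g], so the point [g (R_t + u L_t)] sits
   at the level [b_t - u (b_t - a_t)] of [phia], which does not depend on [g].
   Drawing [g] from [eta] and [u] uniformly in [0, 1] thus realises all the
   measures of the curve at once, and couples the times [s] and [t] at a
   distance equal to the difference of the two levels.  This coupling is
   optimal: [phia] is 1-Lipschitz, so no coupling costs less than the transport
   between the laws of the levels on the line, where [u] gives the monotone
   (affine) rearrangement.  Levels are affine in [t], whence the geodesic. *)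
Require Import Defs.
From mathcomp Require Import all_boot all_order all_algebra.
From mathcomp Require Import all_classical all_reals all_analysis.
From mathcomp Require Import measurable_realfun ring lra.

Import Order.TTheory GRing.Theory Num.Theory.
Import numFieldNormedType.Exports.

Local Open Scope classical_set_scope.
Local Open Scope ring_scope.

Set Implicit Arguments.
Unset Strict Implicit.
Unset Printing Implicit Defensive.

(** * Second countability and measurability of open sets in products *)

Lemma separable_second_countable (R : realType) (T : pseudoPMetricType R)
  (S : set T) : countable S -> dense S -> @second_countable T.
Proof.
move=> cS dS.
(* Balls of a pseudometric structure need not be open, hence the interiors. *)
pose b (z : T * nat) : set T := (ball z.1 (z.2.+1%:R^-1 : R))°.
exists (b @` (S `*` setT)).
  by apply: card_le_trans (card_image_le _ _) _; apply: countableX.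
split=> [_ [z _ <-]|x V /nbhs_ballP[e /= e0 eV]]; first exact: open_interior.
(* With the radius below [e / 2], such a ball around a dense point close to [x] stays within [e] of
   [x]. *)
have [|n ne] := @ltr_add_invr R 0 (e / 2); first by rewrite divr_gt0.
rewrite add0r in ne.
have n0 : 0 < n.+1%:R^-1 :> R by rewrite invr_gt0.
have n20 : 0 < n.+1%:R^-1 / 2 :> R by rewrite divr_gt0.
have [|y [/interior_subset xy Sy]] :=
  dS (ball x (n.+1%:R^-1 / 2))° _ (open_interior _).
  by exists x; exact: nbhsx_ballx.
exists (b (y, n)).
  split; first by exists (y, n).
  apply/nbhs_ballP; exists (n.+1%:R^-1 / 2) => //= z xz.
  rewrite -[ball _ _ _]/(ball y n.+1%:R^-1 z) [X in ball _ X _]splitr.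
  by apply: ball_triangle xz; exact: ball_sym.
move=> z /interior_subset/= yz; apply: eV; rewrite [e]splitr.
apply: (@ball_triangle _ _ y); last exact: le_ball (ltW ne) _ yz.
apply: le_ball (ltW ne) _ _; apply: le_ball xy.
by rewrite ler_pdivrMr// ler_peMr ?invr_ge0// ler1n.
Qed.

Lemma R_second_countable (R : realType) : @second_countable R.
Proof.
apply: (@separable_second_countable R R _ _ (@dense_rat R)).
by apply: card_le_trans (card_image_le _ _) _; exact: countableP.
Qed.

Lemma measurable_preimage d d' (T : measurableType d) (T' : measurableType d')
    (f : T -> T') (A : set T') :
  measurable_fun setT f -> measurable A -> measurable (f @^-1` A).
Proof. by move=> mf mA; rewrite -[X in measurable X]setTI; exact: mf. Qed.

Lemma measurable_open (T : ptopologicalType) (A : set T) :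
  open A -> measurable (A : set (borel T)).
Proof. exact: sub_sigma_algebra. Qed.

Lemma open_preimage_measurable_fun d (T : measurableType d)
    (T' : ptopologicalType) (f : T -> borel T') :
  (forall U : set T', open U -> measurable (f @^-1` U)) ->
  measurable_fun setT f.
Proof.
move=> fU; apply: (measurability _ (erefl (@open T').-sigma.-measurable)).
by move=> _ [U oU <-]; rewrite setTI; exact: fU.
Qed.

Lemma open_preimage_measurable_funR (R : realType) d (T : measurableType d)
    (f : T -> R) :
  (forall U : set R, open U -> measurable (f @^-1` U)) ->
  measurable_fun setT f.
Proof.
move=> fU; apply: (measurability _ (RGenOpens.measurableE R)).
by move=> _ [_ [a [b ->] <-]]; rewrite setTI; apply/fU/interval_open.
Qed.

(** For each [U] in the countable base, [C U] is the largest open set whose product with [U] lies in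
    [A], and these rectangles cover [A]. Since [C U] may be any open set, countability is asked of
    the first factor alone, so that the second can be the space of geodesics. *)
Lemma measurable_open_prod (T1 T2 : ptopologicalType) (A : set (T1 * T2)) :
  @second_countable T1 -> open A ->
  measurable (A : set (borel T1 * borel T2)%type).
Proof.
move=> [B cB [Bo Bb]] oA.
pose C (U : set T1) := [set y | U `*` [set y] `<=` A]°.
have -> : A = \bigcup_(U in B) (U `*` C U).
  apply/seteqP; split => [[x y] Axy|[x y] [U BU [/= Ux]]].
    have [[P Q] /= [Px Qy] PQ] := open_nbhs_nbhs (conj oA Axy).
    have [U [BU Ux] UP] := Bb x P Px.
    exists U => //; split => //=; apply: filterS Qy => z Qz [x' y'] [/= Ux' ->].
    by apply: PQ; split => //=; exact: UP.
  by move=> /interior_subset/=; apply.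
rewrite bigcup_set_type; apply: countable_bigcupT_measurable => [|U].
  by rewrite (eq_countable (card_setT B)).
apply: measurableX.
  by apply: measurable_open; apply: Bo; exact: set_valP.
by apply: measurable_open; exact: open_interior.
Qed.

(** * Projection of the line onto the unit interval *)

Section unit_clamp.
Context {R : realType}.
Implicit Types s t u : R.

(** The expression is the one in [geodesic_ext], which thus reads [g s = g (unit_clamp s)]. *)
Definition unit_clamp u : R := Num.min 1 (Num.max 0 u).

Lemma unit_clamp_itv u : 0 <= unit_clamp u <= 1.
Proof. by rewrite le_min ler01 le_max lexx/= ge_min lexx. Qed.

Lemma unit_clamp_id u : 0 <= u <= 1 -> unit_clamp u = u.
Proof. by move=> /andP[u0 u1]; rewrite /unit_clamp max_r// min_r. Qed.

Lemma unit_clamp_norm_le1 u : `|unit_clamp u| <= 1.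
Proof. by have /andP[u0 u1] := unit_clamp_itv u; rewrite ger0_norm. Qed.

Lemma unit_clamp_lipschitz s t : `|unit_clamp s - unit_clamp t| <= `|s - t|.
Proof.
wlog st : s t / s <= t => [st|].
  have [/st//|/ltW/st] := leP s t.
  by rewrite distrC => /le_trans -> //; rewrite distrC.
rewrite /unit_clamp /Num.min /Num.max ler_norml [`|s - t|]distrC.
rewrite [`|t - s|]ger0_norm ?subr_ge0//.
by case: (ltP 0 s) => s0; case: (ltP 0 t) => t0; do 2?case: ifPn => ?;
  apply/andP; split; lra.
Qed.

Lemma measurable_unit_clamp : measurable_fun setT unit_clamp.
Proof. by apply: measurable_minr => //; exact: measurable_maxr. Qed.

End unit_clamp.

(** * Continuity and measurability of evaluation and distance *)

Section geodesics.
Context {R : realType} (X : pmetricType R).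

(** The uniform topology controls times in [[0, 1]]; by [geodesic_ext] the curve takes no other
    values at the remaining times. *)
Lemma nbhs_geodesic (g : geodesic X) (e : R) : 0 < e ->
  nbhs g [set h : geodesic X | forall t, mdist (g t) (h t) < e].
Proof.
move=> e0.
suff : nbhs (g : initial_topology (@geodesic_uniform_fun R X))
  (@geodesic_uniform_fun R X @^-1`
    [set h | forall t, `[0, 1]%classic t -> mdist (g t) (h t) < e]).
  apply: filterS => h gh t; rewrite geodesic_ext [h t]geodesic_ext.
  apply: gh; rewrite /= in_itv/=.
  by rewrite ge_min le_min ler01 !le_max !lexx/= ?orbT.
apply: initial_continuous.
apply/uniform_nbhs; exists [set z | mdist z.1 z.2 < e]; split => //.
have -> : [set z : X * X | mdist z.1 z.2 < e] = [set z | ball z.1 e z.2].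
  by apply/seteqP; split => z /=; rewrite ballEmdist.
exact: (@entourage_ball _ _ (PosNum e0)).
Qed.

Lemma geodesic_lipschitz (g : geodesic X) (s t : R) :
  mdist (g s) (g t) <= `|s - t| * mdist (g 0) (g 1).
Proof.
rewrite [g s]geodesic_ext [g t]geodesic_ext geodesic_speed ?unit_clamp_itv//.
by rewrite ler_wpM2r ?mdist_ge0// unit_clamp_lipschitz.
Qed.

(** The path from [g s] to [h t] goes through [g t]: the first leg is small by the Lipschitz bound
    for [g], the second by uniform closeness of [h] to [g]. *)
Lemma joint_ev_continuous :
  continuous (fun z : R * geodesic X => (z.2 z.1 : X)).
Proof.
move=> [s g] /= U /nbhs_ballP[e /= e0 eU].
have e20 : 0 < e / 2 by rewrite divr_gt0.
set l := mdist (g 0) (g 1).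
have l0 : 0 <= l by exact: mdist_ge0.
(* The denominator is [l + 1] because a constant geodesic has [l = 0]. *)
have d0 : 0 < e / 2 / (l + 1) by rewrite divr_gt0// ltr_wpDl.
exists (ball s (e / 2 / (l + 1)),
  [set h : geodesic X | forall t, mdist (g t) (h t) < e / 2]).
  by split; [exact: nbhsx_ballx | exact: nbhs_geodesic].
move=> [t h] /= [st gh]; apply: eU; rewrite ballEmdist/=.
apply: le_lt_trans (metric_triangle _ (g t) _) _.
rewrite [e]splitr ler_ltD//; apply: le_trans (geodesic_lipschitz _ _ _) _.
rewrite -/l; apply: (@le_trans _ _ (e / 2 / (l + 1) * l)).
  by rewrite ler_wpM2r// ltW.
by rewrite mulrAC ler_pdivrMr ?ltr_wpDl// ler_wpM2l ?lerDl// ltW.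
Qed.

Lemma measurable_joint_ev : measurable_fun setT (@joint_ev R X).
Proof.
(* The time factor is moved to the sigma-algebra generated by open sets, where
   [measurable_open_prod] applies. *)
have m1 : measurable_fun setT
    (fun z : measurableTypeR R * borel (geodesic X) => (z.1 : borel R, z.2)).
  apply: measurable_fun_pair => //; apply: open_preimage_measurable_fun => U oU.
  apply: (measurable_preimage (f := fst)) => //.
  exact: open_measurable.
apply: open_preimage_measurable_fun => U oU.
apply: (measurable_preimage
  (A := [set z : borel R * borel (geodesic X) | U ((z.2 : geodesic X) z.1)]) m1).
apply: (@measurable_open_prod R (geodesic X)
  [set z : R * geodesic X | U (z.2 z.1)]); first exact: R_second_countable.
by move: joint_ev_continuous => /continuousP; apply.
Qed.

Lemma measurable_ev (t : R) : measurable_fun setT (@ev R X t).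
Proof.
have mt : measurable_fun setT
    (fun g : borel (geodesic X) => (t : measurableTypeR R, g)).
  exact: measurable_fun_pair.
exact: (measurableT_comp measurable_joint_ev mt).
Qed.

Lemma continuous_mdist : continuous (fun z : X * X => mdist z.1 z.2).
Proof.
move=> [x y] U /nbhs_ballP[e /= e0 eU].
have e20 : 0 < e / 2 by rewrite divr_gt0.
exists (ball x (e / 2), ball y (e / 2)); first by split; exact: nbhsx_ballx.
move=> [x' y'] /= []; rewrite !ballEmdist/= => xx' yy'; apply: eU => /=.
have := metric_triangle x x' y; have := metric_triangle x' y' y.
have := metric_triangle x' x y'; have := metric_triangle x y y'.
rewrite /ball/= (metric_sym y' y) (metric_sym x' x) => h1 h2 h3 h4.
by rewrite ltr_norml; apply/andP; split; lra.
Qed.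

(** Separability places the open sets of the product space in the product of the two Borel
    sigma-algebras; continuity of the distance then suffices. *)
Lemma measurable_mdist : separable_space X ->
  measurable_fun setT (fun z : (borel X * borel X)%type => mdist (z.1 : X) (z.2 : X)).
Proof.
move=> [S cS dS]; apply: open_preimage_measurable_funR => U oU.
apply: (@measurable_open_prod X X [set z : X * X | U (mdist z.1 z.2)]).
  exact: separable_second_countable cS dS.
by move: continuous_mdist => /continuousP; apply.
Qed.

End geodesics.

(** * Uniform laws on intervals *)

Lemma uniform_prob01E (R : realType) (E : set R) : measurable E ->
  uniform_prob (@ltr01 R) E = lebesgue_measure (`[0, 1] `&` E).
Proof.
move=> mE; rewrite /uniform_prob integral_uniform_pdf.
rewrite (eq_integral (cst 1%E)) => [|u]; last first.
  by rewrite inE/= in_itv/= => -[_ u01]; rewrite /uniform_pdf u01 subr0 invr1.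
rewrite integral_cst ?mul1e 1?setIC//.
exact: measurableI.
Qed.

Lemma measurable_affine (R : realType) (r l : R) :
  measurable_fun setT (fun u : R => r + u * l).
Proof. by apply: measurable_funD => //; exact: measurable_funM. Qed.

(** The right-hand side is a measure in [A] that gives half-open intervals their length, so
    uniqueness of Lebesgue measure applies. *)
Lemma lebesgue_measure_affine (R : realType) (r l : R) (A : set R) : 0 < l ->
  measurable A ->
  lebesgue_measure A = (l%:E * lebesgue_measure ((fun u => r + u * l)%R @^-1` A))%E.
Proof.
move=> l0 mA.
pose f : measurableTypeR R -> measurableTypeR R := fun u => r + u * l.
have mf : measurable_fun setT f by exact: measurable_affine.
have [m mE] : exists m : {measure set (measurableTypeR R) -> \bar R},
    forall B, m B = lebesgue_measure (f @^-1` B).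
  by unshelve eexists (pushforward lebesgue_measure f : {measure set _ -> \bar R}).
rewrite -mE -[RHS]/(mscale (NngNum (ltW l0)) m A).
apply: lebesgue_measure_unique => //= _ [[a b]] _ <-.
rewrite /mscale/= mE.
have -> : f @^-1` `]a, b] = `](a - r) / l, (b - r) / l]%classic.
  apply/seteqP; split => u /=; rewrite !in_itv/= /f.
    by rewrite ltr_pdivrMr// ler_pdivlMr// ltrBlDl lerBrDl.
  by rewrite ltr_pdivrMr// ler_pdivlMr// ltrBlDl lerBrDl.
rewrite !lebesgue_measure_itv/= !lte_fin ltr_pM2r ?invr_gt0// ltrD2r.
case: ifPn => _; last by rewrite mule0.
rewrite -!EFinB -EFinM; congr EFin; field.
by rewrite gt_eqF.
Qed.

(** This trades normalised Lebesgue measure on an interval, the integrand of [uniform_layer], for a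
    uniform variable [u] whose law no longer depends on the interval. *)
Lemma uniform_prob01_affine (R : realType) (r l : R) (A : set R) : 0 < l ->
  measurable A ->
  uniform_prob (@ltr01 R) ((fun u => r + u * l) @^-1` A) =
  (l^-1%:E * lebesgue_measure (`[r, (r + l)%R] `&` A))%E.
Proof.
move=> l0 mA; rewrite uniform_prob01E; last first.
  exact: (measurable_preimage (@measurable_affine R r l)).
rewrite [in RHS](lebesgue_measure_affine r l0); last exact: measurableI.
rewrite muleA -EFinM mulVf ?gt_eqF// mul1e preimage_setI.
congr (lebesgue_measure (_ `&` _)%classic).
apply/seteqP; split => u /=; rewrite !in_itv/=.
  by rewrite lerDl lerD2l ger_pMl// pmulr_lge0.
by rewrite lerDl lerD2l ger_pMl// pmulr_lge0.
Qed.

(** * Integrals and events modulo a null set *)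

Section full_measure.
Local Open Scope ereal_scope.
Context d (T : measurableType d) (R : realType) (P : probability T R).
Variables (D : set T) (mD : measurable D) (PD : P D = 1).

Lemma full_setC : P (~` D) = 0.
Proof. by rewrite probability_setC// PD subee. Qed.

Lemma full_ge0_integral (f g : T -> \bar R) :
  measurable_fun setT f -> measurable_fun setT g ->
  (forall x, 0 <= f x) -> (forall x, 0 <= g x) -> {in D, f =1 g} ->
  \int[P]_x f x = \int[P]_x g x.
Proof.
move=> mf mg f0 g0 fg; apply: ge0_ae_eq_integral => //.
exists (~` D); split; [exact: measurableC | exact: full_setC |].
by move=> x /= + Dx; apply => _; apply: fg; rewrite inE.
Qed.

Lemma full_measure_eq (A B : set T) : measurable A -> measurable B ->
  D `&` A = D `&` B -> P A = P B.
Proof.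
move=> mA mB AB.
have PI C : measurable C -> P C = P (D `&` C).
  move=> mC; rewrite -[in LHS](setIT C) -(setUv D) setIUr measureU.
  - rewrite [X in _ + X](_ : _ = 0) ?adde0 1?setIC//.
    apply: (@subset_measure0 _ _ _ _ _ (~` D)) => //.
      by apply: measurableI => //; exact: measurableC.
      exact: measurableC.
    exact: full_setC.
  - exact: measurableI.
  - by apply: measurableI => //; exact: measurableC.
  - by rewrite setIACA setICr setI0.
by rewrite PI// AB -PI.
Qed.

End full_measure.

(** * Quadratic transport on the real line *)

Section transport_cost_on_the_line.
Local Open Scope ereal_scope.
Context d d' (Z : measurableType d) (U : measurableType d') (R : realType).
Variables (P : probability Z R) (Q : probability U R).

(** Both sides are the integral of [h] against the common law; integrability is transferred first,
    by the same argument for the absolute value of [h]. *)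
Lemma same_law_integral (x : Z -> R) (x' : U -> R) (h : R -> R) :
  measurable_fun setT x -> measurable_fun setT x' -> measurable_fun setT h ->
  (forall B : set R, measurable B -> P (x @^-1` B) = Q (x' @^-1` B)) ->
  Q.-integrable setT (EFin \o (h \o x')) ->
  P.-integrable setT (EFin \o (h \o x)) /\
  \int[P]_z (h (x z))%:E = \int[Q]_u (h (x' u))%:E.
Proof.
move=> mx mx' mh law ih.
have mEh : measurable_fun setT (EFin \o h) by exact/measurable_EFinP.
have push f : \int[pushforward P x]_t f t = \int[pushforward Q x']_t f t.
  by apply: eq_measure_integral => A mA _; exact: law.
have ihP : P.-integrable setT ((EFin \o h) \o x).
  apply/integrableP; split; first exact: measurableT_comp.
  move/integrableP : ih => [_]; apply: le_lt_trans.
  rewrite -[leLHS](ge0_integral_pushforward mx P measurableT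
    (f := fun t => `|(h t)%:E|)) ?push ?ge0_integral_pushforward//.
  - exact: measurableT_comp.
  - exact: measurableT_comp.
split => //; rewrite -[LHS](integral_pushforward mx mEh ihP measurableT) push.
exact: integral_pushforward.
Qed.

(** Weak duality. The integrals of [f x] and [g y] depend on the marginal laws alone; [f x + g y]
    never exceeds the cost since [0 < al], and equals it when [y = al * x + be], as happens under
    [Q]. *)
Lemma monotone_transport_optimal (x y : Z -> R) (x' y' : U -> R) (al be M : R) :
  measurable_fun setT x -> measurable_fun setT y ->
  measurable_fun setT x' ->
  (forall B : set R, measurable B -> P (x @^-1` B) = Q (x' @^-1` B)) ->
  (forall B : set R, measurable B -> P (y @^-1` B) = Q (y' @^-1` B)) ->
  (0 < al)%R -> (forall u, y' u = al * x' u + be)%R ->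
  (forall u, `|x' u| <= M)%R ->
  \int[Q]_u ((x' u - y' u) ^+ 2)%:E <= \int[P]_z ((x z - y z) ^+ 2)%:E.
Proof.
move=> mx my mx' lx ly al0 y'E xM.
(* Dual potentials: [(x - y)^2 - f x - g y = (al x + be - y)^2 / al]. *)
pose f (t : R) : R := ((1 - al) * t ^+ 2 - 2 * be * t)%R.
pose g (t : R) : R := (t ^+ 2 - al^-1 * (t - be) ^+ 2)%R.
have my' : measurable_fun setT y'.
  have -> : y' = (fun t => be + t * al)%R \o x'.
    by apply/funext => u; rewrite /= y'E addrC mulrC.
  exact: measurableT_comp (@measurable_affine R be al) mx'.
have mf : measurable_fun setT f.
  by apply: measurable_funB; apply: measurable_funM.
have mg : measurable_fun setT g.
  apply: measurable_funB => //; apply: measurable_funM => //.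
  by apply: measurable_funX; exact: measurable_funB.
(* Everything integrated against [Q] is a quadratic polynomial in [x'], which [M] bounds. *)
have int_quad (h : U -> R) (c2 c1 c0 : R) :
    (forall u, h u = c2 * x' u ^+ 2 + c1 * x' u + c0)%R ->
    Q.-integrable setT (EFin \o h).
  move=> /funext ->; apply: measurable_bounded_integrable => //.
  - exact: le_lt_trans (probability_le1 Q measurableT) (ltry _).
  - apply: measurable_funD => //; apply: measurable_funD => //.
      by apply: measurable_funM => //; exact: measurable_funX.
    exact: measurable_funM.
  - exists (`|c2| * M ^+ 2 + `|c1| * M + `|c0|)%R; split; first exact: num_real.
    move=> K /ltW KM u _; apply: le_trans KM.
    apply: le_trans (ler_normD _ _) _; rewrite lerD2r.
    apply: le_trans (ler_normD _ _) _; rewrite (normrM c2) (normrM c1) normrX.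
    by rewrite lerD// ler_wpM2l// lerXn2r// nnegrE (le_trans _ (xM u)).
have ifx : Q.-integrable setT (EFin \o (f \o x')).
  by apply: (int_quad _ (1 - al) (- (2 * be)) 0)%R => u /=; rewrite /f; ring.
have igy : Q.-integrable setT (EFin \o (g \o y')).
  apply: (int_quad _ (al ^+ 2 - al) (2 * al * be) (be ^+ 2))%R => u /=.
  by rewrite /g y'E; field; rewrite gt_eqF.
have ixy : Q.-integrable setT (fun u => ((x' u - y' u) ^+ 2)%:E).
  apply: (int_quad _ ((1 - al) ^+ 2) (- (2 * (1 - al) * be)) (be ^+ 2))%R => u.
  by rewrite y'E; ring.
have [ifxP fE] := same_law_integral mx mx' mf lx ifx.
have [igyP gE] := same_law_integral my my' mg ly igy.
have -> : \int[Q]_u ((x' u - y' u) ^+ 2)%:E =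
    \int[P]_z ((f (x z))%:E + (g (y z))%:E).
  rewrite integralD// fE gE -integralD//; apply: eq_integral => u _.
  by rewrite -EFinD /f /g y'E; congr EFin; field; rewrite gt_eqF.
have mxy : measurable_fun setT (fun z => ((x z - y z) ^+ 2)%:E).
  by apply/measurable_EFinP; apply: measurable_funX; exact: measurable_funB.
(* An infinite cost leaves nothing to prove; a finite one is integrable, as the comparison of signed
   integrands requires. *)
have [xyoo|] := ltP (\int[P]_z ((x z - y z) ^+ 2)%:E) +oo; last first.
  by rewrite leye_eq => /eqP ->; rewrite leey.
apply: le_integral => //.
- exact: integrableD.
- apply/integrableP; split => //; apply: le_lt_trans xyoo.
  by rewrite le_eqVlt; apply/orP; left; apply/eqP/eq_integral => z _;
    rewrite gee0_abs// lee_fin sqr_ge0.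
- move=> z _; rewrite -EFinD lee_fin /f /g -subr_ge0.
  have -> : ((x z - y z) ^+ 2 - ((1 - al) * x z ^+ 2 - 2 * be * x z +
      (y z ^+ 2 - al^-1 * (y z - be) ^+ 2)) =
      al^-1 * (al * x z + be - y z) ^+ 2)%R.
    by field; rewrite gt_eqF.
  by rewrite mulr_ge0 ?invr_ge0 ?sqr_ge0// ltW.
Qed.

End transport_cost_on_the_line.

(** * The layered measure as the law of a random time and geodesic *)

Section measure.
Local Open Scope ereal_scope.

Lemma pushforward_is_probability d d' (T : measurableType d)
    (T' : measurableType d') (R : realType) (P : probability T R)
    (f : T -> T') : measurable_fun setT f ->
  exists P' : probability T' R, forall A, P' A = P (f @^-1` A).
Proof.
move=> mf.
pose f_ : {mfun T >-> T'} :=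
  MeasurableFun.Pack (MeasurableFun.Class (isMeasurableFun.Build _ _ _ _ _ mf)).
by exists (distribution P f_).
Qed.

(** The inverse is the power of exponent -1, both being 0 at 0. *)
Lemma measurable_inv_ge0 d (T : measurableType d) (R : realType) (f : T -> R) :
  (forall x, 0 <= f x)%R -> measurable_fun setT f ->
  measurable_fun setT (fun x => (f x)^-1)%R.
Proof.
move=> f0 mf; under eq_fun do rewrite -powR_inv1//.
exact: measurableT_comp (measurable_powR _) mf.
Qed.

(** Slice by slice this is [uniform_prob01_affine]. The functions [rho] and [lam] supply the
    measurability, about which nothing is known for [r] and [l] outside [H]. *)
Lemma uniform_layerE (R : realType) (X : pmetricType R)
    (eta : probability (borel (geodesic X)) R) (H : set (borel (geodesic X)))
    (r l : geodesic X -> R) (rho lam : borel (geodesic X) -> R)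
    (A : set (measurableTypeR R * borel (geodesic X))) :
  measurable H -> eta H = 1 ->
  measurable_fun setT rho -> measurable_fun setT lam ->
  (forall g, H g -> r g = rho g) -> (forall g, H g -> l g = lam g) ->
  (forall g, H g -> 0 < lam g)%R -> measurable A ->
  uniform_layer eta H r l A = (eta \x uniform_prob (@ltr01 R))
    ((fun z => (rho z.1 + z.2 * lam z.1, z.1)%R) @^-1` A).
Proof.
move=> mH etaH mrho mlam rE lE lam0 mA.
set Psi := fun z : borel (geodesic X) * measurableTypeR R =>
  ((rho z.1 + z.2 * lam z.1)%R : measurableTypeR R, z.1).
have mPsi : measurable_fun setT Psi.
  apply: measurable_fun_pair => //; apply: measurable_funD.
    exact: measurableT_comp mrho measurable_fst.
  by apply: measurable_funM => //; exact: measurableT_comp mlam measurable_fst.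
have mB : measurable (Psi @^-1` A) by exact: measurable_preimage.
pose F g := uniform_prob (@ltr01 R) (xsection (Psi @^-1` A) g).
have mF : measurable_fun setT F by exact: measurable_fun_xsection.
transitivity (\int[eta]_(g in H) F g).
  apply: eq_integral => g /set_mem Hg; rewrite rE// lE// /F.
  rewrite -uniform_prob01_affine; [|exact: lam0|exact: measurable_ysection].
  by congr (uniform_prob _ _); apply/seteqP; split => u;
    rewrite /xsection /ysection /= !inE.
(* The product measure of a set is by definition the integral of the measures of its sections over
   all [g], and the complement of [H] is null. *)
rewrite integral_mkcond; apply: (full_ge0_integral mH etaH) => //.
- by apply/measurable_restrict => //; rewrite setIidr//; exact: measurable_funTS.
- by move=> g; rewrite patchE; case: ifP.
- by move=> g gH; rewrite patchE gH.
Qed.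

End measure.

(** * Computing [W2] through a 1-Lipschitz function *)

Section optimal_transport.
Local Open Scope ereal_scope.
Context {R : realType} (X : pmetricType R) (Xsep : separable_space X).
Context d (Z : measurableType d) (Q : probability Z R).
Variables (D : set Z) (mD : measurable D) (QD : Q D = 1).
Variables (psi : X -> R) (psi_lip : forall x y, (`|psi x - psi y| <= mdist x y)%R).

Lemma measurable_lipschitz : measurable_fun setT (psi : borel X -> R).
Proof.
apply: open_preimage_measurable_funR => U oU; apply: measurable_open.
move: U oU; apply/continuousP => x; apply/cvgrPdist_lt => /= e e0.
apply/nbhs_ballP; exists e => //= y; rewrite ballEmdist/=.
exact: le_lt_trans (psi_lip _ _).
Qed.

Lemma W2_monotone (mu nu : set (borel X) -> \bar R) (x y : Z -> borel X)
    (x' y' : Z -> R) (al be M : R) :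
  measurable_fun setT x -> measurable_fun setT y -> measurable_fun setT x' ->
  (forall A, measurable A -> mu A = Q (x @^-1` A)) ->
  (forall A, measurable A -> nu A = Q (y @^-1` A)) ->
  {in D, psi \o x =1 x'} -> {in D, psi \o y =1 y'} ->
  {in D, forall z, mdist (x z : X) (y z : X) = `|x' z - y' z|%R} ->
  (0 < al)%R -> (forall z, y' z = al * x' z + be)%R ->
  (forall z, `|x' z| <= M)%R ->
  W2 mu nu = (\int[Q]_z ((x' z - y' z) ^+ 2)%:E) `^ 2^-1.
Proof.
move=> mx my mx' muE nuE xE yE dE al0 y'E xM; congr (_ `^ _).
have mpsi := measurable_lipschitz; have md := measurable_mdist Xsep.
have my' : measurable_fun setT y'.
  by move/funext : y'E => ->; apply: measurable_funD => //; exact: measurable_funM.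
have mcost : measurable_fun setT (fun z : (borel X * borel X)%type =>
    (mdist (z.1 : X) (z.2 : X) ^+ 2)%:E).
  by apply/measurable_EFinP; exact: measurable_funX.
have law (v : Z -> borel X) (v' : Z -> R) (B : set R) : measurable_fun setT v ->
    measurable_fun setT v' -> {in D, psi \o v =1 v'} -> measurable B ->
    Q (v @^-1` (psi @^-1` B)) = Q (v' @^-1` B).
  move=> mv mv' vE mB; apply: (full_measure_eq mD QD).
  - by apply: (measurable_preimage mv); exact: (measurable_preimage mpsi).
  - exact: (measurable_preimage mv').
  - apply/seteqP; split => z [Dz] vB; split => //.
      by rewrite /= -(vE z (mem_set Dz)).
    by move: vB; rewrite /= -(vE z (mem_set Dz)).
(* Upper bound: the joint law of [x] and [y] under [Q] is a coupling, and on [D] its cost is that of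
   the levels. *)
apply/eqP; rewrite eq_le; apply/andP; split.
  have mxy := measurable_fun_pair mx my.
  have [pi piE] := pushforward_is_probability Q mxy.
  apply: ereal_inf_lbound; exists pi.
    by move=> A mA; rewrite !piE muE// nuE//; split; congr (Q _);
      apply/seteqP; split => z//= [].
  rewrite /quadratic_cost.
  rewrite (eq_measure_integral (pushforward Q (fun z => (x z, y z)))) => [|A mA _].
    rewrite (ge0_integral_pushforward mxy)//; last first.
      by move=> z _; rewrite lee_fin sqr_ge0.
    apply: (full_ge0_integral mD QD) => //=.
    - exact: (measurableT_comp mcost mxy).
    - apply/measurable_EFinP; apply: measurable_funX; exact: measurable_funB.
    - by move=> z; rewrite lee_fin sqr_ge0.
    - by move=> z; rewrite lee_fin sqr_ge0.
    - by move=> z zD; rewrite /= dE// real_normK// num_real.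
  exact: piE.
(* Lower bound: [psi] sends any coupling to one between the laws of [x'] and [y'] without raising
   the cost, and on the line the increasing affine map is optimal. *)
apply: le_ereal_inf_tmp => _ [pi cpi <-].
have m1 : measurable_fun setT (fun z : (borel X * borel X)%type => psi z.1).
  exact: measurableT_comp mpsi measurable_fst.
have m2 : measurable_fun setT (fun z : (borel X * borel X)%type => psi z.2).
  exact: measurableT_comp mpsi measurable_snd.
apply: (@le_trans _ _ (\int[pi]_z ((psi z.1 - psi z.2) ^+ 2)%:E)).
  apply: (monotone_transport_optimal m1 m2 mx' _ _ al0 y'E xM) => B mB.
    rewrite -(law x)// -muE; last exact: (measurable_preimage mpsi).
    have [<- _] := cpi _ (measurable_preimage mpsi mB).
    by congr (pi _); apply/seteqP; split => z//= [].
  rewrite -(law y)// -nuE; last exact: (measurable_preimage mpsi).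
  have [_ <-] := cpi _ (measurable_preimage mpsi mB).
  by congr (pi _); apply/seteqP; split => z//= [].
apply: ge0_le_integral => //.
- by move=> z _; rewrite lee_fin sqr_ge0.
- by apply/measurable_EFinP; apply: measurable_funX; exact: measurable_funB.
- move=> z _; rewrite lee_fin -(real_normK (num_real (psi z.1 - psi z.2)%R)).
  by rewrite lerXn2r// ?nnegrE ?mdist_ge0.
Qed.

End optimal_transport.

(** * The curve of layers and its geodesic property *)

Theorem proposition4p7 (R : realType) (X : pmetricType R)
  (m : {measure set (borel X) -> \bar R})
  (Xgeo : geodesic_space X) (Xnb : non_branching X) (Xsep : separable_space X)
  (mu : R -> probability (borel X) R)
  (mu_P2 : forall t, 0 <= t <= 1 -> finite_second_moment (mu t))
  (mu_geo : W2_geodesic (fun t => mu t : set (borel X) -> \bar R))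
  (Gam : probability (borel (geodesic X)) R)
  (Gam_ev : forall t, 0 <= t <= 1 -> forall A : set (borel X), measurable A ->
     pushforward Gam (ev t) A = mu t A)
  (Gam_opt : optimal_coupling (mu 0) (mu 1) (pushforward Gam (ev2 0 1)))
  (G : set (geodesic X)) (G_def : G = supp Gam)
  (G_pos : forall g, G g -> 0 < mdist (g 0) (g 1))
  (phi : X -> \bar R) (phi_pot : kantorovich_potential (mu 0) (mu 1) phi)
  (a : R) (a_phi : (phi @` supp (mu 0)) a%:E)
  (Ga : set (geodesic X)) (Ga_def : Ga = [set g | G g /\ phi (g 0) = a%:E])
  (phia : X -> R)
  (phia_lip : forall x y, `|phia x - phia y| <= mdist x y)
  (phia_pot : forall g, Ga g -> forall s t, 0 <= s -> s <= t -> t <= 1 ->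
     phia (g s) - phia (g t) = mdist (g s) (g t))
  (a0 b0 a1 b1 : R) (b0a0 : a0 < b0) (a0b1 : b1 < a0) (b1a1 : a1 < b1)
  (H : set (borel (geodesic X))) (mH : measurable H) (HGa : H `<=` Ga)
  (H0 : forall g : geodesic X, H g ->
     `]a0, b0[ `<=` [set phia (g s) | s in `]0, 1[])
  (H1 : forall g : geodesic X, H g ->
     `]a1, b1[ `<=` [set phia (g s) | s in `]0, 1[])
  (R0 L0 R1 L1 : geodesic X -> R)
  (RL0 : forall g : geodesic X, H g -> crossing_times phia a0 b0 g (R0 g) (L0 g))
  (RL1 : forall g : geodesic X, H g -> crossing_times phia a1 b1 g (R1 g) (L1 g))
  (eta : probability (borel (geodesic X)) R) (eta_H : eta H = 1%E) :
  let nu (t : R) := uniform_layer eta H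
    (fun g => (1 - t) * R0 g + t * R1 g)
    (fun g => (1 - t) * L0 g + t * L1 g) in
  (forall t, 0 <= t <= 1 ->
     is_probability (nu t) /\ nu t (`[0, 1] `*` Ga) = 1%E) /\
  W2_geodesic (fun t => pushforward (nu t) (@joint_ev R X)).
Proof.
pose c (x0 x1 t : R) := (1 - t) * x0 + t * x1.
(* Clamping keeps the level bounded everywhere, not only almost surely. *)
pose T t (z : borel (geodesic X) * measurableTypeR R) :=
  c b0 b1 t - unit_clamp z.2 * (c b0 b1 t - c a0 a1 t).
pose len (g : borel (geodesic X)) := mdist ((g : geodesic X) 0) ((g : geodesic X) 1).
(* Closed forms of the interpolated times, obtained by solving for the levels along [g]; they are
   measurable in [g]. *)
pose rho t (g : borel (geodesic X)) := (phia ((g : geodesic X) 0) - c b0 b1 t) / len g.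
pose lam t (g : borel (geodesic X)) := (c b0 b1 t - c a0 a1 t) / len g.
pose Psi t (z : borel (geodesic X) * measurableTypeR R) :=
  ((rho t z.1 + z.2 * lam t z.1 : measurableTypeR R), z.1).
pose Q : probability _ R := (eta \x uniform_prob (@ltr01 R))%E.
pose D : set (borel (geodesic X) * measurableTypeR R) := H `*` `[0, 1].
have mD : measurable D by exact: measurableX.
have QD : Q D = 1%E.
  transitivity (eta H * uniform_prob (@ltr01 R) `[0%R, 1%R])%E.
    exact: product_measure1E.
  rewrite eta_H uniform_prob01E// setIid mul1e.
  by rewrite lebesgue_measure_itv/= lte_fin ltr01 oppr0 adde0.
have len_gt0 g : H g -> 0 < len g.
  by move=> /HGa; rewrite Ga_def => -[/G_pos].
have gap_gt0 t : 0 <= t <= 1 -> 0 < c b0 b1 t - c a0 a1 t.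
  move=> /andP[t0 t1].
  have -> : c b0 b1 t - c a0 a1 t = (1 - t) * (b0 - a0) + t * (b1 - a1).
    by rewrite /c; ring.
  have [->|tn0] := eqVneq t 0; first by rewrite subr0 mul1r mul0r addr0 subr_gt0.
  rewrite ltr_wpDl ?mulr_ge0 ?subr_ge0// ?ltW//.
  by rewrite mulr_gt0 ?subr_gt0// lt_neqAle eq_sym tn0.
have phia_len g t : H g -> 0 <= t <= 1 ->
    phia ((g : geodesic X) t) = phia ((g : geodesic X) 0) - t * len g.
  move=> Hg t01; have /andP[t0 t1] := t01.
  have := phia_pot _ (HGa _ Hg) _ _ (lexx 0) t0 t1.
  rewrite geodesic_speed ?lexx ?ler01// sub0r normrN ger0_norm// -/(len g).
  by move=> <-; rewrite opprB addrC subrK.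
(* Along [g] the potential is affine in time with slope [- len g], which is nonzero, so a level
   determines its time. *)
have crossE g (b a' r l : R) : H g -> crossing_times phia a' b g r l ->
    r = (phia ((g : geodesic X) 0) - b) / len g /\ l = (b - a') / len g.
  move=> Hg [r01 l01 rl01 <- <-].
  rewrite (phia_len _ _ Hg r01) (phia_len _ _ Hg rl01).
  by split; field; rewrite gt_eqF// len_gt0.
have rhoE t g : H g -> (1 - t) * R0 g + t * R1 g = rho t g.
  move=> Hg; have [-> _] := crossE _ _ _ _ _ Hg (RL0 _ Hg).
  have [-> _] := crossE _ _ _ _ _ Hg (RL1 _ Hg).
  by rewrite /rho /c; field; rewrite gt_eqF// len_gt0.
have lamE t g : H g -> (1 - t) * L0 g + t * L1 g = lam t g.
  move=> Hg; have [_ ->] := crossE _ _ _ _ _ Hg (RL0 _ Hg).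
  have [_ ->] := crossE _ _ _ _ _ Hg (RL1 _ Hg).
  by rewrite /lam /c; field; rewrite gt_eqF// len_gt0.
have lam_gt0 t g : 0 <= t <= 1 -> H g -> 0 < lam t g.
  by move=> t01 Hg; rewrite divr_gt0 ?gap_gt0 ?len_gt0.
(* The time lies between [rho t g] and [rho t g + lam t g], both convex combinations of crossing
   times in [[0, 1]]. *)
have in01 t g u : 0 <= t <= 1 -> H g -> 0 <= u <= 1 -> 0 <= rho t g + u * lam t g <= 1.
  move=> t01 Hg /andP[u0 u1]; have lt0 := ltW (lam_gt0 _ _ t01 Hg).
  have [/andP[r00 r01] _ /andP[_ rl01] _ _] := RL0 _ Hg.
  have [/andP[r10 r11] _ /andP[_ rl11] _ _] := RL1 _ Hg.
  have /andP[t0 t1] := t01.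
  apply/andP; split.
    apply: addr_ge0; last exact: mulr_ge0.
    by rewrite -rhoE// addr_ge0 ?mulr_ge0// subr_ge0.
  apply: (@le_trans _ _ (rho t g + lam t g)); first by rewrite lerD2l ler_piMl.
  rewrite -rhoE// -lamE//.
  have : 0 <= (1 - t) * (1 - (R0 g + L0 g)) by rewrite mulr_ge0 ?subr_ge0.
  have : 0 <= t * (1 - (R1 g + L1 g)) by rewrite mulr_ge0 ?subr_ge0.
  lra.
have mev (t : R) : measurable_fun setT (fun g : borel (geodesic X) => phia (ev t g)).
  exact: (measurableT_comp (measurable_lipschitz phia_lip) (measurable_ev (X := X) t)).
have mlenV : measurable_fun setT (fun g => (len g)^-1).
  apply: measurable_inv_ge0 => [g|]; first exact: mdist_ge0.
  apply: (measurableT_comp (measurable_mdist Xsep)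
    (measurable_fun_pair (measurable_ev 0) (measurable_ev 1))).
have mrho t : measurable_fun setT (rho t).
  by apply: measurable_funM => //; apply: measurable_funB => //; exact: mev.
have mlam t : measurable_fun setT (lam t) by exact: measurable_funM.
have mPsi t : measurable_fun setT (Psi t).
  apply: measurable_fun_pair => //; apply: measurable_funD.
    exact: measurableT_comp (mrho t) measurable_fst.
  apply: measurable_funM => //.
  exact: measurableT_comp (mlam t) measurable_fst.
have mPhi t : measurable_fun setT (@joint_ev R X \o Psi t).
  exact: measurableT_comp (@measurable_joint_ev R X) (mPsi t).
have mT t : measurable_fun setT (T t).
  apply: measurable_funB => //; apply: measurable_funM => //.
  exact: measurableT_comp measurable_unit_clamp measurable_snd.
have DT t : 0 <= t <= 1 -> {in D, phia \o (@joint_ev R X \o Psi t) =1 T t}.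
  move=> t01 [g u] /set_mem[/= Hg u01]; rewrite in_itv/= in u01.
  rewrite /joint_ev/= /ev phia_len ?in01// /T unit_clamp_id//=.
  by rewrite /rho /lam; field; rewrite gt_eqF// len_gt0.
move=> nu.
have nuE t : 0 <= t <= 1 -> forall A, measurable A -> nu t A = Q (Psi t @^-1` A).
  move=> t01 A mA; apply: uniform_layerE => // g Hg; [exact: rhoE|exact: lamE|].
  exact: lam_gt0.
have pushE t : 0 <= t <= 1 -> forall A, measurable A ->
    pushforward (nu t) (@joint_ev R X) A = Q ((@joint_ev R X \o Psi t) @^-1` A).
  move=> t01 A mA; rewrite /pushforward nuE//.
  exact: (measurable_preimage (@measurable_joint_ev R X)).
have W2E s t : 0 <= s <= 1 -> 0 <= t <= 1 ->
    W2 (pushforward (nu s) (@joint_ev R X)) (pushforward (nu t) (@joint_ev R X)) =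
    (`|s - t|%:E * (\int[Q]_z ((T 0 z - T 1 z) ^+ 2)%:E) `^ 2^-1)%E.
  move=> s01 t01.
  (* Slope of the affine map from the level interval at [s] onto the one at [t]; [be] is then fixed
     by matching the upper ends. *)
  pose al := (c b0 b1 t - c a0 a1 t) / (c b0 b1 s - c a0 a1 s).
  rewrite (W2_monotone Xsep mD QD phia_lip (mPhi s) (mPhi t) (mT s) (pushE s s01)
    (pushE t t01) (DT s s01) (DT t t01)
    (al := al) (be := c b0 b1 t - al * c b0 b1 s)
    (M := `|c b0 b1 s| + `|c b0 b1 s - c a0 a1 s|)).
  (* For fixed [z] the level [T t z] is affine in [t], so the cost scales by [(s - t) ^+ 2]. *)
  - under eq_integral => z _.
      have -> : (T s z - T t z) ^+ 2 = (s - t) ^+ 2 * (T 0 z - T 1 z) ^+ 2.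
        by rewrite /T /c; ring.
      rewrite EFinM; over.
    rewrite ge0_integralZl ?lee_fin ?sqr_ge0//; last 2 first.
      by apply/measurable_EFinP; apply: measurable_funX; exact: measurable_funB.
      by move=> z _; rewrite lee_fin sqr_ge0.
    rewrite poweRM ?lee_fin ?sqr_ge0//; last first.
      by apply: integral_ge0 => z _; rewrite lee_fin sqr_ge0.
    by rewrite poweR_EFin powR12_sqrt ?sqr_ge0// sqrtr_sqr.
  (* Both points lie on the same geodesic, where distance is time difference times [len g], that is,
     the difference of levels. *)
  - move=> [g u] /set_mem[/= Hg u01]; rewrite in_itv/= in u01.
    rewrite /joint_ev/= /ev geodesic_speed ?in01// -/(len g).
    rewrite -(ger0_norm (ltW (len_gt0 _ Hg))) -normrM -normrN; congr `|_|.
    rewrite /T unit_clamp_id//= /rho /lam.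
    by field; rewrite gt_eqF// len_gt0.
  - by rewrite divr_gt0 ?gap_gt0.
  - move=> z; rewrite /T /al; field.
    by rewrite gt_eqF ?gap_gt0.
  - move=> z; apply: le_trans (ler_normB _ _) _; rewrite lerD2l normrM.
    by rewrite ler_piMl ?unit_clamp_norm_le1.
split=> [t t01|].
  split.
    have [P PE] := pushforward_is_probability Q (mPsi t).
    by exists P => A mA; rewrite PE nuE.
  (* The integrand is 1 on [H]: the section of the target set is [[0, 1]], which contains the whole
     layer interval, of length [lam t g]. *)
  rewrite -eta_H /nu /uniform_layer -[RHS]mul1e -integral_cst//.
  apply: eq_integral => g /set_mem Hg; rewrite lamE// rhoE//.
  have lt0 := lam_gt0 _ _ t01 Hg.
  have -> : ysection (`[0, 1] `*` Ga) g = `[0, 1]%classic :> set R.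
    apply/seteqP; split => [u|u u01]; first by rewrite ysectionE => -[].
    by rewrite ysectionE; split => //; exact: HGa.
  rewrite setIidl => [|u /=].
    rewrite lebesgue_measure_itv/= lte_fin ltrDl lt0 -EFinB addrAC subrr add0r.
    by rewrite -EFinM mulVf// gt_eqF.
  rewrite !in_itv/= => /andP[ru ur].
  have /andP[r0 _] : 0 <= rho t g + 0 * lam t g <= 1 by apply: in01; rewrite ?lexx ?ler01.
  have /andP[_ r1] : 0 <= rho t g + 1 * lam t g <= 1 by apply: in01; rewrite ?lexx ?ler01.
  rewrite mul0r addr0 in r0; rewrite mul1r in r1.
  by rewrite (le_trans r0 ru) (le_trans ur r1).
have z01 : 0 <= (0 : R) <= 1 by rewrite lexx ler01.
have o01 : 0 <= (1 : R) <= 1 by rewrite lexx ler01.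
split => [t t01||s t s01 t01].
- have [P PE] := pushforward_is_probability Q (mPhi t).
  by exists P => A mA; rewrite PE pushE.
- rewrite (W2E 0 1)// sub0r normrN normr1 mul1e poweR_lty//.
  have : Q.-integrable setT (EFin \o (fun z => (T 0 z - T 1 z) ^+ 2)).
    apply: measurable_bounded_integrable => //.
    - exact: le_lt_trans (probability_le1 Q measurableT) (ltry _).
    - by apply: measurable_funX; exact: measurable_funB.
    - exists ((`|b0 - b1| + `|b0 - a0 - (b1 - a1)|) ^+ 2); split; first exact: num_real.
      move=> K /ltW KM z _; apply: le_trans KM; rewrite normrX.
      rewrite lerXn2r// ?nnegrE ?addr_ge0//.
      have -> : T 0 z - T 1 z = (b0 - b1) - unit_clamp z.2 * (b0 - a0 - (b1 - a1)).
        by rewrite /T /c; ring.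
      apply: le_trans (ler_normB _ _) _; rewrite lerD2l normrM.
      by rewrite ler_piMl ?unit_clamp_norm_le1.
  by move=> /integrable_lty; apply.
- rewrite (W2E s t)// (W2E 0 1)//.
  by rewrite sub0r normrN normr1 mul1e.
Qed.
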